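(* Let $\gamma \in (0,1)$ and let $B \subset \mathbb{T} = \mathbb{R}/\mathbb{Z}$ be the ternary fat Cantor set with parameter $\gamma$ (constructed in the context). Put $L_j = \gamma\, 2^{-j} + (1-\gamma)\, 3^{-j}$ for integers $j \ge 0$ and $x_j = \frac{1}{2}(L_{j-1} - L_j)$ for $j \in \mathbb{N}$. Then $B$ is a fat Cantor set with $\mu(B) = \gamma$, and the Fourier transform of its characteristic function is $$\widehat{\chi_B}(k) = \mu(B) \prod_{j \in \mathbb{N}} \cos(2\pi x_j k), \qquad k \in \mathbb{Z}.$$
   Context: $\mathbb{N} = \{1,2,3,\dots\}$; $\mathbb{T} = \mathbb{R}/\mathbb{Z}$ is the circle group with Haar probability measure $\mu$. For $f \in L^2(\mathbb{T})$, $\widehat f(k) = \int_{\mathbb{T}} f(x) e^{-2\pi i k x}\,dx$, $k \in \mathbb{Z}$. A fat Cantor set is a subset of $\mathbb{T}$ that is homeomorphic to Cantor's ternary set and has positive Haar measure. Construction of the ternary fat Cantor set with parameter $\gamma\in(0,1)$: let $S_0 = [-\frac12,\frac12]$. For $j \ge 1$, $S_{j-1}$ is a disjoint union of $2^{j-1}$ closed intervals of equal length; from each of them remove the open middle interval (i.e. the one with the same center) of length $3^{-j}(1-\gamma)$, and let $S_j$ be the resulting set. It is a disjoint union of $2^j$ closed intervals, each of length $L_j = \gamma 2^{-j} + (1-\gamma)3^{-j}$. Put $S = \bigcap_{j \in \mathbb{N}} S_j$ and let $B = S + \mathbb{Z} \subset \mathbb{T}$ be the image of $S$ in $\mathbb{T}$.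 (The number $x_j=\frac12(L_{j-1}-L_j)$ is the distance between the center of the rightmost interval of $S_{j-1}$ and the center of the rightmost interval of $S_j$.) *)

(* Defs.v *)
From HB Require Import structures.
From mathcomp Require Import all_boot all_order all_algebra.
From mathcomp Require Import all_classical all_reals all_analysis.
From mathcomp Require Import ring_quotient complex ring lra.

Set Implicit Arguments.
Unset Strict Implicit.
Unset Printing Implicit Defensive.

Import Order.TTheory GRing.Theory Num.Theory.
Import numFieldNormedType.Exports.

Local Open Scope classical_set_scope.
Local Open Scope ring_scope.
Local Open Scope complex_scope.
Local Open Scope quotient_scope.

Section integers.
Context (R : realType).

Definition integers : {pred R} := fun x => x \is a Num.int.

Let integers_zmod_closed : zmod_closed integers.
Proof. by split=> [|x y]; [exact: rpred0 | exact: rpredB]. Qed.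
HB.instance Definition _ :=
  GRing.isZmodClosed.Build R integers integers_zmod_closed.

End integers.

Section circle.
Context (R : realType).

Definition circle : Type := quotient_topology (@Quotient.quot R (@integers R)).

HB.instance Definition _ := Quotient.on circle.
HB.instance Definition _ := Topological.on circle.
HB.instance Definition _ :=
  GRing.Zmodule.copy circle (@Quotient.quot R (@integers R)).
HB.instance Definition _ := isPointed.Build circle 0.
(* the Borel sigma-algebra *)
HB.instance Definition _ :=
  Measurable.copy circle (g_sigma_algebraType (@open circle)).

Definition proj (t : R) : circle := \pi_circle t.

Lemma proj_eq (s t : R) : proj s = proj t <-> s - t \is a Num.int.
Proof.
have -> : (s - t \is a Num.int) = integers (s - t) by [].
rewrite -[integers _]/(s - t \in @integers R) Quotient.idealrBE.
split => [st|/eqP]; last exact. by apply/eqP; exact: st.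
Qed.

Lemma projD (s t : R) : proj (s + t) = proj s + proj t.
Proof. exact: (@Quotient.pi_add R (@integers R)). Qed.

Lemma proj_surj (x : circle) : exists t, proj t = x.
Proof. by exists (repr x); exact: reprK. Qed.

Lemma proj_continuous : continuous proj.
Proof. exact: pi_continuous. Qed.

Lemma measurable_proj : measurable_fun [set: R] proj.
Proof.
apply: (@measurability _ _ _ _ _ _ (@open circle)) => //.
move=> _ [U oU <-]; rewrite setTI; apply: measurable_realfun.open_measurable.
by move/continuousP: proj_continuous; exact.
Qed.

Let I01 : set R := `[0, 1[.
Let mI01 : @measurable _ (measurableTypeR R) I01.
Proof. exact: measurable_itv. Qed.

(* Haar measure: the image of Lebesgue measure on the fundamental domain
   [0, 1[; it is a translation-invariant probability (haar_translation). *)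
Definition haar : set circle -> \bar R :=
  pushforward (mrestr lebesgue_measure mI01) proj.

Lemma haarE (A : set circle) :
  haar A = lebesgue_measure (proj @^-1` A `&` `[0, 1[).
Proof. by []. Qed.




Let mproj (A : set circle) : measurable A ->
  @measurable _ (measurableTypeR R) (proj @^-1` A).
Proof. by move=> mA; rewrite -[X in measurable X]setTI; exact: measurable_proj. Qed.

Let haar0 : haar set0 = 0%E.
Proof. by rewrite haarE preimage_set0 set0I measure0. Qed.

Let haar_ge0 A : (0 <= haar A)%E.
Proof. by rewrite haarE; exact: measure_ge0. Qed.

Let haar_sigma_additive : semi_sigma_additive haar.
Proof.
move=> F mF tF mU; rewrite /haar /pushforward preimage_bigcup.
apply: measure_semi_sigma_additive => [n||].
- by apply: mproj; exact: mF.
- apply/trivIsetP => /= i j _ _ ij; rewrite -preimage_setI.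
  by move/trivIsetP : tF => /(_ _ _ Logic.I Logic.I ij) ->; rewrite preimage_set0.
- by rewrite -preimage_bigcup; exact: mproj.
Qed.

HB.instance Definition _ := isMeasure.Build _ _ _ haar
  haar0 haar_ge0 haar_sigma_additive.

Let haar_setT : haar [set: circle] = 1%E.
Proof.
rewrite haarE preimage_setT setTI lebesgue_measure_itv/= lte01.
by rewrite -EFinD subr0.
Qed.

HB.instance Definition _ := Measure_isProbability.Build _ _ _ haar haar_setT.

Let lebesgue_shift (a : R) (A : set R) : @measurable _ (measurableTypeR R) A ->
  lebesgue_measure ((fun x => x + a) @^-1` A) = lebesgue_measure A.
Proof.
move=> mA; pose f : measurableTypeR R -> measurableTypeR R := fun x => x + a.
have mf : measurable_fun setT f.
  exact: (@measurable_realfun.measurable_funD _ _ R setT id (cst a)).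
rewrite -[LHS]/(pushforward lebesgue_measure f A).
apply/esym/lebesgue_measure_unique => //= _ [[c b]] _ <-.
rewrite /pushforward.
have -> : f @^-1` `]c, b] = `]c - a, b - a]%classic.
  by apply/seteqP; split=> x /=; rewrite !in_itv/= ltrBlDr lerBrDr.
rewrite !lebesgue_measure_itv/= !lte_fin ltrD2r.
by case: ifP => // _; congr EFin; lra.
Qed.

Let window (E : set R) (s : R) : \bar R :=
  lebesgue_measure (E `&` `[s, s + 1[).

Let window_shift (E : set R) (a s : R) : @measurable _ (measurableTypeR R) E ->
  window ((fun x => x + a) @^-1` E) s = window E (s + a).
Proof.
move=> mE; rewrite /window.
rewrite -(@lebesgue_shift a (E `&` `[s + a, s + a + 1[)); last first.
  by apply: measurableI => //; exact: measurable_itv.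
congr lebesgue_measure; apply/seteqP.
split=> x [Ex]; rewrite /= !in_itv/= => /andP[h1 h2]; split=> //=;
  by rewrite ?in_itv/=; apply/andP; split; lra.
Qed.

Let window_periodic (E : set R) (s : R) : @measurable _ (measurableTypeR R) E ->
  (forall x (n : int), E (x + n%:~R) <-> E x) -> window E s = window E 0.
Proof.
move=> mE pE.
have shE (n : int) : (fun x => x + n%:~R) @^-1` E = E.
  by apply/seteqP; split=> x /=; rewrite pE.
have sh (n : int) u : window E (u + n%:~R) = window E u.
  by rewrite -window_shift// shE.
suff aux u : 0 <= u < 1 -> window E u = window E 0.
  have := sh (- Num.floor s) s; rewrite mulrNz => <-; apply: aux.
  by rewrite subr_ge0 floor_le ltrBlDl -(intrD _ _ 1) floorD1_gt.
move=> /andP[u0 u1].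
have mI (i : interval R) : @measurable _ (measurableTypeR R) (E `&` [set` i]).
  by apply: measurableI => //; exact: measurable_itv.
have -> : window E u = (lebesgue_measure (E `&` `[u, 1[)%R +
    lebesgue_measure (E `&` `[1, u + 1[)%R)%E.
  rewrite -measureU//.
    congr lebesgue_measure; rewrite -setIUr; congr (_ `&` _).
    apply/seteqP; split=> x /=; rewrite !in_itv/=; last first.
      by case=> /andP[? ?]; apply/andP; split; lra.
    move=> /andP[ux xu]; case: (ltP x 1) => x1; [left|right]; first by rewrite ux.
    exact: xu.
  apply/seteqP; split=> // x [[_ /=]]; rewrite in_itv/= => /andP[_ x1] [_ /=].
  by rewrite in_itv/= => /andP[x1' _]; lra.
have -> : window E 0 = (lebesgue_measure (E `&` `[0, u[)%R +
    lebesgue_measure (E `&` `[u, 1[)%R)%E.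
  rewrite -measureU//.
    congr lebesgue_measure; rewrite -setIUr; congr (_ `&` _).
    apply/seteqP; split=> x /=; rewrite !in_itv/= ?add0r; last first.
      by case=> /andP[? ?]; apply/andP; split; lra.
    move=> /andP[ux xu]; case: (ltP x u) => x1; [left|right]; first by rewrite ux.
    exact: xu.
  apply/seteqP; split=> // x [[_ /=]]; rewrite in_itv/= => /andP[_ x1] [_ /=].
  by rewrite in_itv/= => /andP[x1' _]; lra.
rewrite addeC; congr (_ + _)%E.
rewrite -(@lebesgue_shift 1 (E `&` `[1, u + 1[)); last exact: mI.
congr lebesgue_measure; apply/seteqP; split=> x [Ex];
  rewrite /= !in_itv/= => /andP[h1 h2]; (split => /=;
  [exact/(pE x 1) | by rewrite ?in_itv/=; apply/andP; split; lra]).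
Qed.

Lemma haar_translation (a : circle) (A : set circle) : measurable A ->
  haar ((fun x => a + x) @` A) = haar A.
Proof.
have [t <-] := proj_surj a => mA; rewrite !haarE.
set E := proj @^-1` A.
have -> : proj @^-1` [set proj t + x | x in A] = (fun x => x + - t) @^-1` E.
  apply/seteqP; split => x /=.
    move=> [y]; have [s <-] := proj_surj y => As yx.
    by rewrite /E /preimage/= projD -yx -!projD addrAC subrr add0r.
  move=> Ex; exists (proj (x - t)) => //.
  by rewrite -projD addrC subrK.
have mE : @measurable _ (measurableTypeR R) E by exact: mproj.
have := window_shift (- t) 0 mE; rewrite /window !add0r => ->.
rewrite -/(window E (- t)) window_periodic// /window ?add0r//.
move=> x n; rewrite /E/=; have -> // : proj (x + n%:~R) = proj x.
by apply/proj_eq; rewrite addrAC subrr add0r.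
Qed.

End circle.

Section fourier.
Context (R : realType).

(* x |-> e^{2 i pi k x}; repr picks a representative in R of a point of the
   circle, and echarE shows that the choice is immaterial. *)
Definition echar (k : int) (x : circle R) : R[i] :=
  let t := 2 * pi * k%:~R * repr x in cos t +i* sin t.

Let periodicz (f : R -> R) (T a : R) (m : int) :
  periodic f T -> f (a + T * m%:~R) = f a.
Proof.
move=> pf; case: m => n; first by rewrite mulr_natr periodicn.
by rewrite -[LHS](periodicn pf n.+1) NegzE mulrNz mulrN -mulr_natr subrK.
Qed.

Lemma echarE (k : int) (t : R) :
  echar k (proj t) = cos (2 * pi * k%:~R * t) +i* sin (2 * pi * k%:~R * t).
Proof.
rewrite /echar; have /proj_eq/intrP[n /eqP] : proj (repr (proj t)) = proj t.
  exact: reprK.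
rewrite subr_eq => /eqP ->.
have -> : 2 * pi * k%:~R * (n%:~R + t) =
    2 * pi * k%:~R * t + pi *+ 2 * (k * n)%:~R :> R.
  by rewrite intrM mulr2n; ring.
by rewrite !periodicz//; [exact: sinD2pi | exact: cosD2pi].
Qed.

Definition cintegral d (T : measurableType d) (mu : {measure set T -> \bar R})
    (f : T -> R[i]) : R[i] :=
  (\int[mu]_x complex.Re (f x)) +i* (\int[mu]_x complex.Im (f x)).

Definition fourier (f : circle R -> R[i]) (k : int) : R[i] :=
  cintegral (@haar R) (fun x => f x * echar (- k) x).

Definition chi (B : set (circle R)) (x : circle R) : R[i] := (\1_B x)%:C.

End fourier.

Definition homeomorphic (X Y : topologicalType) : Prop :=
  exists (f : X -> Y) (g : Y -> X),
    [/\ cancel f g, cancel g f, continuous f & continuous g].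

Section middle_removal.
Context (R : realType).

Definition itvC (I : R * R) : set R := `[I.1, I.2].

(* the open interval of length l with the same centre as I *)
Definition middle (l : R) (I : R * R) : set R :=
  `](I.1 + I.2) / 2 - l / 2, (I.1 + I.2) / 2 + l / 2[.

Definition split_itv (l : R) (I : R * R) : seq (R * R) :=
  [:: (I.1, (I.1 + I.2) / 2 - l / 2); ((I.1 + I.2) / 2 + l / 2, I.2)].

Lemma split_itvE (l : R) (I : R * R) : 0 <= l -> l <= I.2 - I.1 ->
  itvC I `\` middle l I = \bigcup_(J in [set` split_itv l I]) itvC J.
Proof.
case: I => a b l0 lab; apply/seteqP; split => x; rewrite /itvC /middle /=.
- move=> [] /=; rewrite !in_itv/= => /andP[ax xb] /negP; rewrite negb_and -!leNgt.
  case/orP => h; [exists (a, (a + b) / 2 - l / 2)|exists ((a + b) / 2 + l / 2, b)] => /=.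
  + by rewrite inE eqxx.
  + by rewrite in_itv/= ax.
  + by rewrite !inE eqxx orbT.
  + by rewrite in_itv/= h.
- move=> [J /=]; rewrite in_cons mem_seq1 => /orP[] /eqP -> /=; rewrite !in_itv/= => /andP[? ?];
    (split; first by apply/andP; split; simpl in *; lra);
    by move=> /andP[? ?]; simpl in *; lra.
Qed.

(* Starting from the closed interval I, step j >= 1 removes from each of the
   current intervals the open middle interval of length l j; components I l j
   lists (by endpoints) the 2 ^ j closed intervals left after step j. *)
Fixpoint components (I : R * R) (l : nat -> R) (j : nat) : seq (R * R) :=
  if j is j'.+1 then flatten [seq split_itv (l j) J | J <- components I l j']
  else [:: I].

Definition stage (I : R * R) (l : nat -> R) (j : nat) : set R :=
  \bigcup_(J in [set` components I l j]) itvC J.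

Definition middle_cantor (I : R * R) (l : nat -> R) : set R :=
  \bigcap_j stage I l j.

Lemma size_components (I : R * R) (l : nat -> R) (j : nat) :
  size (components I l j) = (2 ^ j)%N.
Proof.
elim: j => //= j IH; rewrite size_flatten /shape -map_comp sumnE big_map.
by rewrite (eq_bigr (fun=> 2%N)) // big_const_seq count_predT iter_addn_0 IH expnS.
Qed.

Lemma stageS (I : R * R) (l : nat -> R) (j : nat) :
  (forall J, J \in components I l j -> 0 <= l j.+1 <= J.2 - J.1) ->
  stage I l j.+1 =
  \bigcup_(J in [set` components I l j]) (itvC J `\` middle (l j.+1) J).
Proof.
move=> hl; apply/seteqP; split => x.
- move=> [K /= /flattenP[_ /mapP[J Jc ->] KJ] Kx]; exists J => //.
  by have /andP[l0 lJ] := hl _ Jc; rewrite split_itvE//; exists K.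
- move=> [J Jc]; have /andP[l0 lJ] := hl _ Jc.
  rewrite split_itvE// => -[K /= KJ Kx]; exists K => //=.
  by apply/flattenP; exists (split_itv (l j.+1) J) => //; apply/mapP; exists J.
Qed.

(* Before step j the intervals have length 3 ^- j.-1, so that the open middle
   third is removed from each. *)
Definition ternary_cantor : set R := middle_cantor (0, 1) (fun j => 3 ^- j).

Definition fatL (gamma : R) (j : nat) : R :=
  gamma * 2 ^- j + (1 - gamma) * 3 ^- j.

Definition fatx (gamma : R) (j : nat) : R :=
  (fatL gamma j.-1 - fatL gamma j) / 2.

Definition fat_itv : R * R := (- 2^-1, 2^-1).
Definition fat_gap (gamma : R) (j : nat) : R := 3 ^- j * (1 - gamma).

Lemma fat_component_length (gamma : R) (j : nat) (J : R * R) :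
  J \in components fat_itv (fat_gap gamma) j -> J.2 - J.1 = fatL gamma j.
Proof.
elim: j J => [|j IH] J /=.
  by rewrite inE => /eqP ->; rewrite /fatL/= !expr0; lra.
move=> /flattenP[_ /mapP[K /IH hK ->]].
have -> : fatL gamma j.+1 = (fatL gamma j - fat_gap gamma j.+1) / 2.
  by rewrite /fatL /fat_gap !exprSr !invfM; lra.
by rewrite -hK /split_itv !inE => /orP[] /eqP -> /=; lra.
Qed.

Definition fat_set (gamma : R) : set R :=
  middle_cantor fat_itv (fat_gap gamma).

Definition ternary_fat_cantor (gamma : R) : set (circle R) :=
  @proj R @` fat_set gamma.

(* set_type carries the subspace topology *)
Definition is_fat_cantor (B : set (circle R)) : Prop :=
  [/\ measurable B, (0 < haar B)%E &
      homeomorphic (set_type B) (set_type ternary_cantor)].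

End middle_removal.

(* Main.v *)
(* The centres of the 2 ^ n intervals of the n-th stage are the sums
   +-x_1 +- ... +- x_n. Hence, if g x is cos (a x) or sin (a x), the addition
   formulas give sum_c g c = 2 ^ n (prod_j cos (a x_j)) g 0. As the intervals
   have length L_n, by the midpoint rule L_n * sum_c g c tends to the integral
   of g over S, while 2 ^ n L_n tends to gamma. The choices g = 1, cos and sin
   yield the measure, the convergence of the product and the Fourier transform.

   The endpoints 1/2 and -1/2 of S are glued in the circle, but 0 lies in the
   first gap. Cutting the circle at 0 instead of 1/2 therefore exhibits B as a
   homeomorphic copy of a compact subset of R without isolated points and with
   empty interior, and any such set is homeomorphic to the Cantor space. *)

From HB Require Import structures.
From mathcomp Require Import all_boot all_order all_algebra.
From mathcomp Require Import all_classical all_reals all_analysis.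
From mathcomp Require Import measurable_realfun complex ring lra zify.
Require Import Defs.

Set Implicit Arguments.
Unset Strict Implicit.
Unset Printing Implicit Defensive.

Import Order.TTheory GRing.Theory Num.Theory.
Import numFieldNormedType.Exports.

Local Open Scope classical_set_scope.
Local Open Scope ring_scope.
Local Open Scope complex_scope.

(** * Cantor-like subsets of the real line *)

Lemma homeomorphic_sym (X Y : topologicalType) :
  homeomorphic X Y -> homeomorphic Y X.
Proof. by move=> [f [g [fK gK cf cg]]]; exists g, f. Qed.

Lemma homeomorphic_trans (X Y Z : topologicalType) :
  homeomorphic X Y -> homeomorphic Y Z -> homeomorphic X Z.
Proof.
move=> [f [f' [fK f'K cf cf']]] [g [g' [gK g'K cg cg']]].
exists (g \o f), (f' \o g'); split=> [x|z|x|z] /=.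
- by rewrite gK fK.
- by rewrite f'K g'K.
- by apply: continuous_comp; [exact: cf|exact: cg].
- by apply: continuous_comp; [exact: cg'|exact: cf'].
Qed.

(** Closed subsets of the compact [X] are compact, so their images under [f] are compact and hence
    closed in the Hausdorff space [Y]; thus the inverse is continuous. *)
Lemma compact_bijective_homeomorphic (X Y : topologicalType) (f : X -> Y) :
  compact [set: X] -> hausdorff_space Y -> continuous f -> bijective f ->
  homeomorphic X Y.
Proof.
move=> cX hY cf [g fK gK]; exists f, g; split => //.
apply/continuous_closedP => A cA.
have -> : g @^-1` A = f @` A.
  apply/seteqP; split => [y Ay|_ [x Ax <-]]; last by rewrite /preimage/= fK.
  by exists (g y).
apply: compact_closed => //; apply: continuous_compact.
  exact: continuous_subspaceT.
exact: (@subclosed_compact _ _ [set: X]).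
Qed.

Lemma set_val_continuous (X : topologicalType) (A : set X) :
  continuous (set_val : set_type A -> X).
Proof. exact: initial_continuous. Qed.

Lemma continuous_set_val (X Y : topologicalType) (A : set X)
    (f : Y -> set_type A) :
  continuous (set_val \o f) -> continuous f.
Proof. by move=> cf; apply: continuous_comp_initial. Qed.

Lemma hausdorff_set_type (X : topologicalType) (A : set X) :
  hausdorff_space X -> hausdorff_space (set_type A).
Proof.
move=> hX x y xy; apply: val_inj; apply: hX => U V Ux Vy.
have [z [Uz Vz]] := xy _ _ (set_val_continuous Ux) (set_val_continuous Vy).
by exists (set_val z).
Qed.

Lemma compact_set_type (X : topologicalType) (A : set X) :
  compact A -> compact [set: set_type A].
Proof.
move=> cA; have [A0|/set0P[a Aa]] := eqVneq A set0.
  suff -> : [set: set_type A] = set0 by exact: compact0.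
  apply/seteqP; split=> // -[x xA] _.
  by have : set0 x by rewrite -A0; exact: set_mem xA.
(* Points outside [A] go to the default [a], so [f] is total; on [A] it inverts [set_val], which
   exhibits the subtype as a continuous image of [A]. *)
pose f := insubd (exist (fun x => x \in A) a (mem_set Aa)).
have fE (x : set_type A) : f (set_val x) = x by rewrite /f valKd.
have -> : [set: set_type A] = f @` A.
  apply/seteqP; split=> // x _; exists (set_val x); last exact: fE.
  exact: (set_mem (valP x)).
apply: continuous_compact => //; apply/subspace_sigL_continuousP.
suff -> : sigL A f = id by move=> x; exact: cvg_id.
by apply/funext => x; rewrite /sigL/= fE.
Qed.

Section cantor_subset.
Context {R : realType} (K : set R).
Hypothesis compactK : compact K.
Hypothesis perfectK :
  forall x e, K x -> 0 < e -> exists y, [/\ K y, y != x & `|x - y| < e].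
Hypothesis meagerK : forall x y, x < y -> exists2 c, x < c < y & ~ K c.

Lemma cantor_like_set_type : cantor_like (set_type K).
Proof.
split.
(* Perfectness means that no singleton is open: a ball around [x] inside [U] contains a second point
   of [K]. *)
- apply/perfectTP => x [U oU Ux].
  have Kx : K (set_val x) := set_mem (valP x).
  have : U (set_val x) by have : (set_val @^-1` U) x by rewrite Ux.
  move=> Uvx; have /nbhs_ballP[e /= e0 eU] := open_nbhs_nbhs (conj oU Uvx).
  have [y [Ky yx xy]] := perfectK Kx e0.
  have : (set_val @^-1` U) (exist (fun z => z \in K) y (mem_set Ky)).
    exact: eU.
  by rewrite Ux => /(congr1 set_val)/= /eqP; exact/negP.
- exact: compact_set_type.
- exact/hausdorff_set_type/Rhausdorff.
(* A cut at [c] outside [K] is clopen because no point of [K] equals [c]; such cuts separate any two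
   points. *)
- have cut (c : R) : ~ K c -> clopen [set z : set_type K | set_val z < c].
    move=> Kc; split.
      exists [set` `]-oo, c[ ]; first exact: interval_open.
      by apply/seteqP; split=> z /=; rewrite in_itv.
    rewrite (_ : mkset _ = ~` [set z : set_type K | c < set_val z]).
      apply: open_closedC; exists [set` `]c, +oo[ ]; first exact: interval_open.
      by apply/seteqP; split=> z /=; rewrite in_itv/= andbT.
    apply/seteqP; split=> z /=.
      by move=> zc; apply/negP; rewrite -leNgt ltW.
    move=> /negP; rewrite -leNgt le_eqVlt => /predU1P[zc|//].
    by case: Kc; rewrite -zc; exact: (set_mem (valP z)).
  move=> x y xy; have [vxy|vyx|/val_inj/eqP] := ltgtP (set_val x) (set_val y).
  + have [c /andP[xc cy] /cut cc] := meagerK vxy.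
    exists [set z | set_val z < c]; split => //=.
    by apply/negP; rewrite -leNgt ltW.
  + have [c /andP[yc cx] /cut cc] := meagerK vyx.
    exists (~` [set z | set_val z < c]); split => /=.
    * exact: (clopenC set0 cc).
    * by apply/negP; rewrite -leNgt ltW.
    * by apply.
  + by rewrite (negbTE xy).
Qed.

(** This is Brouwer's characterization of the Cantor space; [a] becomes the base point of the
    pointed space [T]. *)
Lemma homeomorphic_cantor_space : K !=set0 ->
  homeomorphic cantor_space (set_type K).
Proof.
move=> [a Ka].
pose p := isPointed.Build (set_type K)
  (exist (fun z => z \in K) a (mem_set Ka)).
pose T : pseudoPMetricType R := HB.pack (set_type K) p.
have [f [cf _]] := @homeomorphism_cantor_like R T cantor_like_set_type.
apply: (@compact_bijective_homeomorphic _ _ (f : cantor_space -> set_type K)).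
- exact: cantor_space_compact.
- by case: cantor_like_set_type.
- exact: cf.
- by rewrite -setTT_bijective; exact: bij.
Qed.

End cantor_subset.

(** * Middle-removal sets *)

Lemma itvCE (R : realType) (J : R * R) x : itvC J x = (J.1 <= x <= J.2) :> Prop.
Proof. by rewrite /itvC/= in_itv. Qed.

Section middle_cantor.
(** [len j] is the common length of the components of stage [j]. The section serves twice: for the
    fat set with [len = fatL gamma], and for the ternary set, where [len j] and [l j] are both
    [3 ^- j]. *)
Context {R : realType} (I : R * R) (l len : nat -> R).
Hypothesis len0 : len 0%N = I.2 - I.1.
Hypothesis lenS : forall j, len j.+1 = (len j - l j.+1) / 2.
Hypothesis len_gt0 : forall j, 0 < len j.
Hypothesis gap_gt0 : forall j, 0 < l j.+1.

Local Notation K := (middle_cantor I l).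

Lemma components_len j J : J \in components I l j -> J.2 - J.1 = len j.
Proof.
elim: j J => [|j IH] J /=; first by rewrite inE => /eqP ->; rewrite len0.
move=> /flattenP[_ /mapP[J' /IH hJ' ->]].
by rewrite lenS /split_itv !inE => /orP[] /eqP -> /=; lra.
Qed.

Lemma lenS_lt j : len j.+1 < len j / 2.
Proof. by rewrite lenS; have := gap_gt0 j; lra. Qed.

Lemma len_le j : len j <= len 0 * 2 ^- j.
Proof.
elim: j => [|j IH]; first by rewrite expr0 invr1 mulr1.
by have := lenS_lt j; rewrite exprSr invfM mulrA; lra.
Qed.

Lemma len_cvg0 : len j @[j --> \oo] --> 0.
Proof.
apply: (@squeeze_cvgr _ _ _ _ (fun=> 0) (fun j => len 0 * 2^-1 ^+ j)).
- by apply: nearW => j; rewrite ltW//= exprVn len_le.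
- exact: cvg_cst.
- rewrite -[X in _ --> X](mulr0 (len 0)); apply: cvgM; first exact: cvg_cst.
  by apply: cvg_expr; rewrite gtr0_norm ?invr_gt0// invf_lt1// ltr1n.
Qed.

Lemma gap_lt_components j J : J \in components I l j -> 0 < l j.+1 < J.2 - J.1.
Proof.
move=> /components_len ->; rewrite gap_gt0 /=.
by have := len_gt0 j.+1; rewrite lenS; lra.
Qed.

(** Splitting leaves two pieces inside their parent with a gap of positive length between them, so
    the left-to-right order of the list survives each step. *)
Lemma components_pairwise j :
  pairwise (fun J1 J2 => J1.2 < J2.1) (components I l j).
Proof.
elim: j => [|j IH]//; have := @gap_lt_components j.
rewrite [components _ _ j.+1]/=; elim: (components _ _ _) IH => //= J s IHs.
move=> /andP[/allP Js ps] hs.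
have /andP[l0 lJ] := hs J (mem_head _ _).
have sE J1 : J1 \in flatten [seq split_itv (l j.+1) J | J <- s] -> J.2 < J1.1.
  move=> /flattenP[_ /mapP[J' J's ->]]; have JJ' := Js _ J's.
  have /andP[_ lJ'] : 0 < l j.+1 < J'.2 - J'.1.
    by apply: hs; rewrite inE J's orbT.
  by rewrite !inE => /orP[] /eqP -> /=; lra.
rewrite IHs ?andbT//; last by move=> J' J's; apply: hs; rewrite inE J's orbT.
apply/andP; split; [apply/andP; split|]; first lra.
  by apply/allP => J' /sE /=; lra.
by apply/allP => J' /sE /=; lra.
Qed.

Lemma components_uniq j (J J' : R * R) x : J \in components I l j ->
  J' \in components I l j -> itvC J x -> itvC J' x -> J = J'.
Proof.
rewrite !itvCE; have := components_pairwise j.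
elim: (components _ _ _) => // J0 s IH /= /andP[/allP Js ps].
rewrite !inE => /predU1P[->|Jc] /predU1P[->|J'c] //=.
- move=> /andP[_ h] /andP[h' _]; exfalso.
  by have h2 : J0.2 < J'.1 := Js _ J'c; clear -h h' h2; lra.
- move=> /andP[h _] /andP[_ h']; exfalso.
  by have h2 : J0.2 < J.1 := Js _ Jc; clear -h h' h2; lra.
- exact: IH.
Qed.

Lemma components_split j (J J' : R * R) : J \in components I l j ->
  J' \in split_itv (l j.+1) J -> J' \in components I l j.+1.
Proof.
move=> Jc J'J /=; apply/flattenP; exists (split_itv (l j.+1) J) => //.
exact: map_f.
Qed.

Lemma stage_nonincreasing : nonincreasing_seq (stage I l).
Proof.
apply/nonincreasing_seqP => j; apply/subsetPset.
rewrite stageS; last first.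
  by move=> J /gap_lt_components /andP[? ?]; apply/andP; split; apply: ltW.
by move=> x [J Jc [Jx _]]; exists J.
Qed.

(** The first piece of a split inherits the left endpoint and the last piece the right one, so
    endpoints are never removed. *)
Lemma component_endpoints n j (J : R * R) : J \in components I l j ->
  (exists2 J1, J1 \in components I l (n + j) & J1.1 = J.1) /\
  (exists2 J2, J2 \in components I l (n + j) & J2.2 = J.2).
Proof.
move=> Jc; elim: n => [|n [[J1 J1c <-] [J2 J2c <-]]]; first by split; exists J.
(* [split_itv] is never empty, so the defaults of [head] and [last] are not reached. *)
split; [exists (head J1 (split_itv (l (n + j).+1) J1)) => //|
        exists (last J2 (split_itv (l (n + j).+1) J2)) => //].
- by apply: (components_split J1c); rewrite inE eqxx.
- by apply: (components_split J2c); rewrite !inE eqxx orbT.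
Qed.

Lemma component_endpoints_middle_cantor j (J : R * R) :
  J \in components I l j -> K J.1 /\ K J.2.
Proof.
move=> Jc; suff h n : stage I l n J.1 /\ stage I l n J.2.
  by split=> n _; have [] := h n.
(* An endpoint lies in stage [n + j] by inheritance, hence in the larger stage [n]. *)
have nj := subsetPset _ _ (stage_nonincreasing (leq_addr j n)).
have [[J1 J1c <-] [J2 J2c <-]] := component_endpoints n Jc.
have := gap_lt_components J1c; have := gap_lt_components J2c => h1 h2.
by split; apply: nj; [exists J1|exists J2] => //; rewrite itvCE; lra.
Qed.

(** Some component of length less than [e] contains [x]; both its endpoints belong to [K], and at
    least one differs from [x]. *)
Lemma middle_cantor_perfect (x e : R) : K x -> 0 < e ->
  exists y, [/\ K y, y != x & `|x - y| < e].
Proof.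
move=> Kx e0; have [j _ jP] := cvgr_lt _ len_cvg0 _ e0; have := jP j (leqnn j).
move=> lenj; have [J /= Jc] := Kx j Logic.I; rewrite itvCE => Jx.
have [K1 K2] := component_endpoints_middle_cantor Jc.
have := components_len Jc; have := gap_lt_components Jc.
have [-> |Jx1] := eqVneq J.1 x => JJ Jl.
  exists J.2; split=> //; [by apply/eqP; lra|].
  by rewrite ltr_norml; lra.
by exists J.1; split=> //; rewrite ltr_norml; lra.
Qed.

(** If all of []x, y[] lay in [K], the segment [[p, q]] inside it would stay within one component at
    every stage, although the lengths of the components tend to 0. *)
Lemma middle_cantor_meager x y : x < y -> exists2 c, x < c < y & ~ K c.
Proof.
move=> xy; apply: contrapT => noc.
have Kc c : x < c < y -> K c.
  by move=> xcy; apply: contrapT => nKc; apply: noc; exists c.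
pose p := x + (y - x) / 3; pose q := y - (y - x) / 3.
have pq : p < q by rewrite /p /q; lra.
have xp : x < p by rewrite /p; lra.
have qy : q < y by rewrite /q; lra.
suff same j : exists J, [/\ J \in components I l j, itvC J p & itvC J q].
  have qp0 : 0 < q - p by rewrite subr_gt0.
  have [j _ jP] := cvgr_lt _ len_cvg0 _ qp0; have := jP j (leqnn j).
  have [J [/components_len <-]] := same j; rewrite !itvCE; lra.
have stg (c : R) i : p <= c <= q -> stage I l i c.
  by move=> pcq; apply: (Kc c) => //; lra.
elim: j => [|j [J [Jc]]].
  have memI (c : R) : p <= c <= q -> itvC I c.
    by move=> /(stg c 0%N)[J /=]; rewrite mem_seq1 => /eqP ->.
  by exists I; rewrite mem_seq1 eqxx; split=> //; apply: memI; lra.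
rewrite !itvCE => Jp Jq.
(* The component of stage [j.+1] containing [c] comes from a parent that also contains [c], and this
   parent is [J] by uniqueness. *)
have child (c : R) : p <= c <= q ->
    J.1 <= c <= (J.1 + J.2) / 2 - l j.+1 / 2 \/
    (J.1 + J.2) / 2 + l j.+1 / 2 <= c <= J.2.
  move=> pcq; have [J2 J2c J2x] := stg c j.+1 pcq.
  move: J2c => /= /flattenP[_ /mapP[J3 J3c ->]] J2J3.
  have J3x : itvC J3 c.
    have := gap_lt_components J3c.
    by move: J2J3 J2x; rewrite !inE !itvCE => /orP[] /eqP -> /=; lra.
  have J3J : J3 = J by apply: (components_uniq J3c Jc J3x); rewrite itvCE; lra.
  by move: J2J3 J2x; rewrite J3J !inE itvCE => /orP[] /eqP -> /=; [left|right].
have := gap_lt_components Jc => JJ.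
have [p1|p2] := child p ltac:(lra); have [q1|q2] := child q ltac:(lra).
- exists (J.1, (J.1 + J.2) / 2 - l j.+1 / 2); rewrite !itvCE; split=> //.
  by apply: components_split Jc _; rewrite inE eqxx.
(* If the gap separated [p] from [q], the midpoint of [J] would lie in [[p, q]], yet it was
   removed. *)
- by have [] := child ((J.1 + J.2) / 2) ltac:(lra); lra.
- lra.
- exists ((J.1 + J.2) / 2 + l j.+1 / 2, J.2); rewrite !itvCE; split=> //.
  by apply: components_split Jc _; rewrite !inE eqxx orbT.
Qed.

Lemma stage_sub n : stage I l n `<=` itvC I.
Proof.
move=> x /(subsetPset _ _ (stage_nonincreasing (leq0n n)))[J /=].
by rewrite mem_seq1 => /eqP ->.
Qed.

Lemma stage_closed n : closed (stage I l n).
Proof.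
by apply: closed_bigcup => [|J _]; [exact: finite_seq|exact: itv_closed].
Qed.

Lemma middle_cantor_sub : K `<=` itvC I.
Proof. by move=> x /(_ 0%N Logic.I); exact: stage_sub. Qed.

Lemma middle_cantor_compact : compact K.
Proof.
apply: (subclosed_compact _ _ middle_cantor_sub); last exact: segment_compact.
by apply: closed_bigI => n _; exact: stage_closed.
Qed.

Lemma middle_cantor_homeomorphic : homeomorphic cantor_space (set_type K).
Proof.
apply: homeomorphic_cantor_space.
- exact: middle_cantor_compact.
- exact: middle_cantor_perfect.
- exact: middle_cantor_meager.
- exists I.1.
  by have [] := @component_endpoints_middle_cantor 0%N I (mem_head _ _).
Qed.

(** * Integrals of Lipschitz functions over a middle-removal set *)

Section integral.
Variables (g : R -> R) (M : R).
Hypothesis g_lipschitz : forall x y, `|g x - g y| <= M * `|x - y|.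

Local Notation mu := (@lebesgue_measure R).
Local Notation midpoint J := ((J.1 + J.2) / 2).

Let lipschitz_ge0 : 0 <= M.
Proof.
have := le_trans (normr_ge0 _) (g_lipschitz 1 0).
by rewrite subr0 normr1 mulr1.
Qed.

Lemma lipschitz_continuous : continuous g.
Proof.
have M0 := lipschitz_ge0.
move=> x; apply/cvgrPdist_lt => e e0; near=> y.
apply: le_lt_trans (g_lipschitz x y) _.
(* [M] may be 0, hence the denominator [M + 1]. *)
have : `|x - y| < e / (M + 1).
  near: y; apply: cvgr_dist_lt; first exact: cvg_id.
  by rewrite divr_gt0// ltr_wpDl.
rewrite ltr_pdivlMr ?ltr_wpDl// => /(le_lt_trans _); apply.
by rewrite mulrC ler_wpM2l// lerDl.
Unshelve. all: by end_near. Qed.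

Lemma integrable_itvC (J : R * R) : mu.-integrable (itvC J) (EFin \o g).
Proof.
apply: continuous_compact_integrable; first exact: segment_compact.
exact/continuous_subspaceT/lipschitz_continuous.
Qed.

Lemma measurable_bigcup_itvC (s : seq (R * R)) :
  measurable (\bigcup_(J in [set` s]) itvC J).
Proof.
apply: fin_bigcup_measurable => [|J _]; first exact: finite_seq.
exact: measurable_itv.
Qed.

(** The order of the list makes the intervals disjoint, and the enclosing interval [J0] supplies
    integrability on their union. *)
Lemma Rintegral_bigcup_itvC (J0 : R * R) (s : seq (R * R)) :
  pairwise (fun J1 J2 => J1.2 < J2.1) s ->
  \bigcup_(J in [set` s]) itvC J `<=` itvC J0 ->
  \int[mu]_(x in \bigcup_(J in [set` s]) itvC J) g x =
  \sum_(J <- s) \int[mu]_(x in itvC J) g x.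
Proof.
elim: s => [|J s IH] /=.
  by rewrite set_nil bigcup_set0 Rintegral_set0 big_nil.
move=> /andP[/allP Js ps]; rewrite big_cons.
rewrite bigcup_seq big_cons -bigcup_seq => sub.
have mJ : measurable (itvC J) by exact: measurable_itv.
have ms := measurable_bigcup_itvC s.
rewrite Rintegral_setU//.
- rewrite IH//; exact: (subset_trans (@subsetUr _ _ _) sub).
- apply: integrableS (integrable_itvC J0) => //; first exact: measurable_itv.
  exact: measurableU.
- apply/disj_setPS => x [Jx [J' /= /Js JJ' J'x]].
  move: JJ' Jx J'x; rewrite !itvCE/= => h1 h2 h3.
  by exfalso; lra.
Qed.

(** On [J] the function differs from its midpoint value by at most [M] times the length; integration
    contributes a second factor of the length. *)
Lemma midpoint_error (J : R * R) : J.1 <= J.2 ->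
  `|\int[mu]_(x in itvC J) g x - (J.2 - J.1) * g (midpoint J)| <=
  M * (J.2 - J.1) ^+ 2.
Proof.
move=> J12.
have M0 := lipschitz_ge0.
have mJ : measurable (itvC J) by exact: measurable_itv.
have muJ : mu (itvC J) = (J.2 - J.1)%:E.
  rewrite /itvC lebesgue_measure_itv/= lte_fin; case: ltP => // J21.
  by congr EFin; lra.
have cstI (c : R) : \int[mu]_(x in itvC J) c = (J.2 - J.1) * c.
  transitivity (c * fine (J.2 - J.1)%:E); last by rewrite /= mulrC.
  by rewrite Rintegral_cst//; congr (_ * fine _); exact: muJ.
have icst (c : R) : mu.-integrable (itvC J) (EFin \o cst c).
  apply: continuous_compact_integrable; first exact: segment_compact.
  by apply: continuous_subspaceT => x; exact: cvg_cst.
rewrite -cstI -RintegralB; [|exact: mJ|exact: integrable_itvC|exact: icst].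
have iB : mu.-integrable (itvC J) (EFin \o (fun x => g x - g (midpoint J))).
  apply: continuous_compact_integrable; first exact: segment_compact.
  apply: continuous_subspaceT => x.
  by apply: cvgB; [exact: lipschitz_continuous|exact: cvg_cst].
apply: le_trans (le_normr_Rintegral _ iB) _ => //.
rewrite expr2 mulrCA -cstI; apply: le_Rintegral => //.
- exact: (integrable_norm iB).
- exact: icst.
- move=> x; rewrite itvCE => Jx; apply: le_trans (g_lipschitz _ _) _.
  by rewrite ler_wpM2l// ler_norml; lra.
Qed.

(** Each of the [2 ^ n] errors is at most [M * len n ^+ 2], and [len_le] bounds the total length
    [2 ^ n * len n] by [len 0]. *)
Lemma Rintegral_stage_midpoint n :
  `|\int[mu]_(x in stage I l n) g x -
    len n * \sum_(J <- components I l n) g (midpoint J)| <= M * len 0 * len n.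
Proof.
rewrite (Rintegral_bigcup_itvC (components_pairwise n) (@stage_sub n)).
rewrite big_distrr/= -sumrB.
apply: le_trans (ler_norm_sum _ _ _) _.
apply: (@le_trans _ _ (\sum_(J <- components I l n) M * len n ^+ 2)).
  rewrite big_seq [leRHS]big_seq; apply: ler_sum => J Jc.
  rewrite -(components_len Jc).
  by apply: midpoint_error; have := gap_lt_components Jc; lra.
rewrite big_const_seq count_predT size_components iter_addr_0.
have M0 := lipschitz_ge0.
rewrite expr2 !mulrA -mulrnAl ler_wpM2r ?(ltW (len_gt0 n))//.
rewrite -mulrnAr ler_wpM2l// -mulr_natr natrX -ler_pdivlMr ?exprn_gt0//.
exact: len_le.
Qed.

(** Dominated convergence on [I], with the absolute value of [g] as bound. Off [K] the restrictions
    of [g] vanish from some stage on, since the stages decrease. *)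
Lemma Rintegral_stage_cvg :
  \int[mu]_(x in stage I l n) g x @[n --> \oo] --> \int[mu]_(x in K) g x.
Proof.
have mst n : measurable (stage I l n) by exact: measurable_bigcup_itvC.
have mK : measurable K by exact: bigcap_measurable.
have mI : measurable (itvC I) by exact: measurable_itv.
have mg : measurable_fun (itvC I) g.
  by apply/measurable_EFinP; case/integrableP: (integrable_itvC I).
have IE (A : set R) : A `<=` itvC I ->
    \int[mu]_(x in A) g x = \int[mu]_(x in itvC I) (g \_ A) x.
  by move=> AI; rewrite -Rintegral_mkcondr; congr Rintegral; rewrite setIidr.
have mgA (A : set R) : measurable A ->
    measurable_fun (itvC I) (fun x => ((g \_ A) x : R)%:E).
  move=> mA; apply/measurable_EFinP/measurable_restrict => //.
  exact: measurable_funS mg.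
rewrite IE; last exact: middle_cantor_sub.
under eq_fun do rewrite (IE _ (@stage_sub _)).
have := @dominated_convergence _ _ R mu (itvC I) mI
  (fun n x => ((g \_ (stage I l n)) x : R)%:E) (fun x => ((g \_ K) x : R)%:E)
  (fun x => `|g x|%:E).
case.
- by move=> n; exact: mgA.
- exact: mgA.
- apply: aeW => x _ /=; apply: cvg_EFin; first by apply: nearW.
  have [Kx|nKx] := pselect (K x).
    rewrite [X in _ --> X](_ : _ = g x); last by rewrite /patch mem_set.
    rewrite (_ : _ \o _ = cst (g x)); first exact: cvg_cst.
    by apply/funext => n /=; rewrite /patch mem_set//; exact: Kx.
  rewrite [X in _ --> X](_ : _ = 0); last by rewrite /patch memNset.
  have [n nx] : exists n, ~ stage I l n x.
    apply: contrapT => h; apply: nKx => n _.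
    by apply: contrapT => nx; apply: h; exists n.
  apply: cvg_near_cst; exists n => // m /= nm; rewrite /patch memNset//.
  by move=> /(subsetPset _ _ (stage_nonincreasing nm)).
- exact/integrable_norm/integrable_itvC.
- apply: aeW => x n _ /=; rewrite lee_fin /patch; case: ifPn => //.
  by rewrite normr0.
move=> iK _ cv; rewrite /Rintegral; apply: fine_cvg.
by rewrite fineK //; exact: integrable_fin_num.
Qed.

Lemma midpoint_sum_cvg :
  len n * (\sum_(J <- components I l n) g (midpoint J)) @[n --> \oo] -->
  \int[mu]_(x in K) g x.
Proof.
apply: (cvg_sub0 _ Rintegral_stage_cvg); apply/norm_cvg0P.
apply: (@squeeze_cvgr _ _ _ _ (fun=> 0) (fun n => M * len 0 * len n)).
- by apply: nearW => n /=; rewrite normr_ge0 distrC Rintegral_stage_midpoint.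
- exact: cvg_cst.
- rewrite -[X in _ --> X](mulr0 (M * len 0)).
  by apply: cvgM; [exact: cvg_cst|exact: len_cvg0].
Qed.

End integral.

(** The two pieces of an interval with centre [c] have centres [c - x] and [c + x], where [x] is
    half of [len n - len n.+1]; the functional equation thus turns each step into a factor
    [2 * f x]. *)
Lemma midpoint_sum (f g : R -> R) n :
  (forall c x, g (c - x) + g (c + x) = 2 * f x * g c) ->
  \sum_(J <- components I l n) g ((J.1 + J.2) / 2) =
  2 ^+ n * (\prod_(1 <= j < n.+1) f ((len j.-1 - len j) / 2)) *
  g ((I.1 + I.2) / 2).
Proof.
move=> gf; elim: n => [|n IH].
  by rewrite big_seq1 big_nil expr0 !mul1r.
rewrite big_nat_recr//= exprSr big_flatten big_map.
transitivity (\sum_(J <- components I l n)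
    2 * f ((len n - len n.+1) / 2) * g ((J.1 + J.2) / 2)).
  rewrite big_seq [RHS]big_seq; apply: eq_bigr => J /components_len Jn.
  rewrite [LHS]big_cons big_seq1 -gf lenS -Jn /=.
  by congr (g _ + g _); field.
by rewrite -big_distrr/= IH; ring.
Qed.

End middle_cantor.

(** * Topology and Haar measure of the circle *)

Section circle.
Context {R : realType}.
Local Notation mu := (@lebesgue_measure R).
Implicit Types (A : set (circle R)) (h : circle R -> R).

(** The preimage of the image is the union of the integer translates of [U]. *)
Lemma open_proj (U : set R) : open U -> open (@proj R @` U).
Proof.
move=> oU; rewrite /open/= /quotient_open.
rewrite (_ : _ @^-1` _ = \bigcup_(n : int) ((fun x => x + n%:~R) @^-1` U)).
  apply: bigcup_open => n _; apply: open_comp => // x _.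
  by apply: cvgD; [exact: cvg_id|exact: cvg_cst].
apply/seteqP; split=> [x [s Us /proj_eq/intrP[n sx]]|x [n _ /= Ux]].
  by exists n => //=; rewrite -sx addrC subrK.
exists (x + n%:~R) => //; apply/proj_eq.
by rewrite addrAC subrr add0r intr_int.
Qed.

Lemma circle_hausdorff : hausdorff_space (circle R).
Proof.
rewrite open_hausdorff => x y; have [s <-] := proj_surj x.
have [t <-] := proj_surj y => /eqP st.
have nst : s - t \isn't a Num.int by apply/negP => /proj_eq.
pose m : R := (Num.floor (s - t))%:~R.
(* Twice [e] is the distance from [s - t] to the integers, so differences of points in the two
   [e]-balls stay strictly between [m] and [m + 1]. *)
pose e := Num.min (s - t - m) (m + 1 - (s - t)) / 2.
have mst : m < s - t.
  rewrite lt_neqAle floor_le andbT; apply: contra nst => /eqP <-.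
  exact: intr_int.
have stm : s - t < m + 1 by rewrite /m -(intrD _ _ 1) floorD1_gt.
have e0 : 0 < e by rewrite divr_gt0// lt_min; apply/andP; split; lra.
have [em em1] : e * 2 <= s - t - m /\ e * 2 <= m + 1 - (s - t).
  by rewrite /e divfK//; split; rewrite ge_min lexx ?orbT.
exists (@proj R @` ball s e, @proj R @` ball t e) => /=.
  by split; rewrite inE; [exists s|exists t] => //; exact: ballxx.
split; [exact/open_proj/ball_open|exact/open_proj/ball_open|].
apply/eqP/seteqP; split=> // z [[s' + <-] [t' + /esym/proj_eq/intrP[n nst']]].
rewrite /ball/= !ltr_norml => s's t't.
have : m < n%:~R :> R by lra.
have : n%:~R < m + 1 :> R by lra.
by rewrite /m -(intrD _ _ 1) !ltr_int => h1 h2; lia.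
Qed.

Lemma continuous_circle_measurable (h : circle R -> R) :
  continuous h -> measurable_fun setT h.
Proof.
move=> /continuousP ch; apply: (measurability _ (RGenOpens.measurableE R)).
move=> _ [_ [a [b ->] <-]]; rewrite setTI; apply: sub_sigma_algebra.
exact/ch/interval_open.
Qed.

Lemma lebesgue_measure_shift (a : R) (A : set R) : measurable A ->
  mu ((fun x => x + a) @^-1` A) = mu A.
Proof.
move=> mA; pose f : measurableTypeR R -> measurableTypeR R := fun x => x + a.
have mf : measurable_fun setT f by exact: measurable_funD.
rewrite -[LHS]/(pushforward mu f A).
apply/esym/lebesgue_measure_unique => //= _ [[c b]] _ <-.
rewrite /pushforward (_ : f @^-1` _ = `]c - a, b - a]%classic); last first.
  by apply/seteqP; split=> x /=; rewrite !in_itv/= ltrBlDr lerBrDr.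
rewrite !lebesgue_measure_itv/= !lte_fin ltrD2r -!EFinB.
by case: ifP => // _; congr EFin; lra.
Qed.

(** Takes the place of the interval [[0, 1[] in [haar], because it contains all of [fat_set] except
    the endpoint 1/2. *)
Definition fundamental_domain : set R := `[- 2^-1, 2^-1[.

Lemma measurable_fundamental_domain :
  @measurable _ (measurableTypeR R) fundamental_domain.
Proof. exact: measurable_itv. Qed.

Lemma haar_fundamental_domain A : measurable A ->
  haar A = mu (@proj R @^-1` A `&` fundamental_domain).
Proof.
move=> mA; rewrite haarE.
have mE : @measurable _ (measurableTypeR R) (@proj R @^-1` A).
  by rewrite -[X in measurable X]setTI; exact: measurable_proj.
have mI (i : interval R) :
    @measurable _ (measurableTypeR R) (@proj R @^-1` A `&` [set` i]).
  by apply: measurableI => //; exact: measurable_itv.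
have itvU (a b c : R) : a <= b <= c ->
    [set` `[a, c[ ] = [set` `[a, b[ ] `|` [set` `[b, c[ ].
  move=> abc; apply/seteqP; split=> x /=; rewrite !in_itv/=; last by lra.
  by case: (ltP x b) => xb; [left|right]; lra.
have itvI (a b c : R) : @proj R @^-1` A `&` `[a, b[%classic `&`
    (@proj R @^-1` A `&` `[b, c[%classic) = set0.
  apply/seteqP; split=> // x [[_ /=]]; rewrite in_itv/= => h [_ /=].
  by rewrite in_itv/=; lra.
rewrite /fundamental_domain (itvU 0 2^-1 1); last lra.
rewrite (itvU (- 2^-1) 0 2^-1); last lra.
rewrite !setIUr !measureU//.
(* The two domains share [[0, 1/2[]; the rest, [[1/2, 1[] and [[-1/2, 0[], match under the shift by
   1, which preserves the preimage of [A]. *)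
rewrite addeC; congr (_ + _)%E; rewrite -[LHS](lebesgue_measure_shift 1 (mI _)).
congr mu; apply/seteqP; split=> x [Ax /=]; rewrite !in_itv/= => hx.
- split; last by rewrite /= ?in_itv/=; lra.
  rewrite /preimage/= in Ax *; rewrite (_ : proj x = proj (x + 1))//.
  by apply/proj_eq; rewrite opprD addNKr rpredN rpred1.
- split; last by rewrite /= ?in_itv/=; lra.
  rewrite /preimage/= in Ax *; rewrite (_ : proj (x + 1) = proj x)//.
  by apply/proj_eq; rewrite addrAC subrr add0r rpred1.
Qed.

(** Change of variables: [haar] is the image under [proj] of the Lebesgue measure [nu] restricted to
    the fundamental domain. Boundedness gives integrability. *)
Lemma Rintegral_haar A h : measurable A -> measurable_fun setT h ->
  (forall x, `|h x| <= 1) ->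
  \int[@haar R]_(x in A) h x =
  \int[mu]_(x in @proj R @^-1` A `&` fundamental_domain) h (proj x).
Proof.
move=> mA mh h1.
pose nu := mrestr mu measurable_fundamental_domain.
have mE : @measurable _ (measurableTypeR R) (@proj R @^-1` A).
  by rewrite -[X in measurable X]setTI; exact: measurable_proj.
have mhp : measurable_fun setT (h \o @proj R).
  by apply: measurableT_comp => //; exact: measurable_proj.
have mEF : @measurable _ (measurableTypeR R)
    (@proj R @^-1` A `&` fundamental_domain).
  by apply: measurableI => //; exact: measurable_fundamental_domain.
have ihp : nu.-integrable (@proj R @^-1` A) ((EFin \o h) \o @proj R).
  apply: measurable_bounded_integrable => //.
  - apply: (@le_lt_trans _ _ (mu fundamental_domain)).
      apply: le_measure; rewrite ?inE//.
      exact: measurable_fundamental_domain.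
    rewrite /fundamental_domain lebesgue_measure_itv/=.
    by case: ifP; rewrite ltry.
  - exact: measurable_funTS.
  - by exists 1; split=> // M M1 x _ /=; apply: le_trans (h1 _) _; exact: ltW.
rewrite /Rintegral; congr fine.
have mp : measurable_fun setT (@proj R : measurableTypeR R -> circle R).
  exact: measurable_proj.
transitivity (\int[pushforward nu (@proj R)]_(x in A) (h x)%:E)%E.
  apply: eq_measure_integral => B mB _; exact: haar_fundamental_domain.
rewrite integral_pushforward//; last exact/measurable_EFinP.
(* The part of the preimage outside the fundamental domain is null for [nu]; on what remains, [nu]
   agrees with [mu]. *)
rewrite (@negligible_integral _ _ _ nu _
  (@proj R @^-1` A `\` fundamental_domain))//; last 2 first.
- by apply: measurableD => //; exact: measurable_fundamental_domain.
- rewrite /nu /= /mrestr (_ : _ `&` _ = set0) ?measure0//.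
  by apply/seteqP; split=> // x [[]].
rewrite setDD; apply: eq_measure_integral => B mB BE.
by rewrite /nu /= /mrestr setIidl// => x /BE[].
Qed.

End circle.

(** * The ternary fat Cantor set *)

(** Mean value theorem on the segment between the points, ordered by symmetry. *)
Lemma lipschitz_of_derive (R : realType) (f df : R -> R) (M : R) :
  (forall x : R, is_derive x 1 f (df x)) -> (forall x, `|df x| <= M) ->
  forall x y, `|f x - f y| <= M * `|x - y|.
Proof.
move=> fdf dfM; wlog xy : / forall x y, y <= x -> `|f x - f y| <= M * `|x - y|.
  apply=> x y yx.
  have cf : {within `[y, x], continuous f}.
    apply: continuous_subspaceT => z; apply/differentiable_continuous.
    by apply/derivable1_diffP; exact: ex_derive.
  have [c _ ->] := MVT_segment yx (fun z _ => fdf z) cf.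
  by rewrite normrM ler_wpM2r.
move=> x y; have [|/ltW] := leP y x; first exact: xy.
by rewrite distrC [`|x - y|]distrC; exact: xy.
Qed.

Section fat_set.
Context {R : realType} (gamma : R).
Hypothesis gamma01 : 0 < gamma < 1.
Local Notation mu := (@lebesgue_measure R).
Local Notation L := (fatL gamma).
Local Notation S := (fat_set gamma).

Lemma fatL0 : L 0%N = (fat_itv R).2 - (fat_itv R).1.
Proof. by rewrite /fatL /= !expr0; lra. Qed.

Lemma fatLS j : L j.+1 = (L j - fat_gap gamma j.+1) / 2.
Proof. by rewrite /fatL /fat_gap !exprSr !invfM; lra. Qed.

Lemma fatL_gt0 j : 0 < L j.
Proof.
have /andP[g0 g1] := gamma01.
by rewrite addr_gt0// mulr_gt0 ?subr_gt0// invr_gt0 exprn_gt0.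
Qed.

Lemma fat_gap_gt0 j : 0 < fat_gap gamma j.+1.
Proof.
have /andP[g0 g1] := gamma01.
by rewrite mulr_gt0 ?subr_gt0// invr_gt0 exprn_gt0.
Qed.

Lemma fat_set_compact : compact S.
Proof. exact: (middle_cantor_compact fatL0 fatLS fatL_gt0 fat_gap_gt0). Qed.

Lemma fat_set_closed : closed S.
Proof. exact: compact_closed (@Rhausdorff R) fat_set_compact. Qed.

Lemma fat_set_perfect (x e : R) : S x -> 0 < e ->
  exists y, [/\ S y, y != x & `|x - y| < e].
Proof. exact: (middle_cantor_perfect fatL0 fatLS fatL_gt0 fat_gap_gt0). Qed.

Lemma fat_set_meager x y : x < y -> exists2 c, x < c < y & ~ S c.
Proof. exact: (middle_cantor_meager fatL0 fatLS fatL_gt0 fat_gap_gt0). Qed.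

Lemma fat_set_itv x : S x -> - 2^-1 <= x <= 2^-1.
Proof.
by move=> /(middle_cantor_sub fatL0 fatLS fatL_gt0 fat_gap_gt0); rewrite itvCE.
Qed.

Lemma fat_set_endpoints : S (- 2^-1) /\ S 2^-1.
Proof.
have := component_endpoints_middle_cantor fatL0 fatLS fatL_gt0 fat_gap_gt0.
by move=> /(_ 0%N (fat_itv R)); rewrite mem_seq1 eqxx => /(_ isT).
Qed.

(** 0 is the centre of the first gap, whose length is positive because [gamma < 1]. *)
Lemma fat_setN0 : ~ S 0.
Proof.
have /andP[g0 g1] := gamma01.
move=> /(_ 1%N Logic.I)[J /=].
rewrite /fat_itv /split_itv /= !inE /fat_gap expr1 => /orP[] /eqP ->;
  by rewrite itvCE /=; lra.
Qed.

(** This is the total length of stage [n]; the excess over [gamma] is a multiple of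
    [(2 / 3) ^+ n]. *)
Lemma expr2_fatL_cvg : 2 ^+ n * L n @[n --> \oo] --> gamma.
Proof.
have -> : (fun n => 2 ^+ n * L n) =
    (fun n => gamma + (1 - gamma) * (2 / 3) ^+ n).
  apply/funext => n; rewrite /fatL mulrDr !(mulrCA (2 ^+ n)) mulfV ?expf_neq0//.
  by rewrite mulr1 expr_div_n.
rewrite -[X in _ --> X]addr0 -[in X in _ --> X](mulr0 (1 - gamma)).
apply: cvgD; first exact: cvg_cst.
apply: cvgM; first exact: cvg_cst.
by apply: cvg_expr; rewrite ger0_norm; lra.
Qed.

(** The midpoint sums converge to the integral and factor by [midpoint_sum]; [g 0] appears because 0
    is the centre of [fat_itv]. *)
Lemma fat_set_integral (f g : R -> R) (M : R) :
  (forall x y, `|g x - g y| <= M * `|x - y|) ->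
  (forall c x, g (c - x) + g (c + x) = 2 * f x * g c) ->
  2 ^+ n * L n * (\prod_(1 <= j < n.+1) f (fatx gamma j) * g 0) @[n --> \oo] -->
  \int[mu]_(x in S) g x.
Proof.
move=> gM gf.
have := midpoint_sum_cvg fatL0 fatLS fatL_gt0 fat_gap_gt0 gM.
apply: cvg_trans; apply: near_eq_cvg; apply: nearW => n.
rewrite (midpoint_sum fatL0 fatLS _ gf) /= addNr mul0r.
by rewrite mulrA [L n * _]mulrA (mulrC (L n)) !mulrA.
Qed.

(** The case [f = g = 1], where the midpoint sum is the total length of the stage. *)
Lemma fat_set_volume : \int[mu]_(x in S) 1 = gamma.
Proof.
have h (c x : R) : (1 : R) + 1 = 2 * 1 * 1 by rewrite !mulr1.
have l (x y : R) : `|(1 : R) - 1| <= 0 * `|x - y| by rewrite subrr normr0 mul0r.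
have := @fat_set_integral (cst 1) (cst 1) 0 l h => /=.
under eq_cvg do rewrite big1_eq !mulr1.
move=> cI; rewrite -(cvg_lim (@Rhausdorff R) cI).
by apply: cvg_lim => //; exact: expr2_fatL_cvg.
Qed.

(** All midpoint sums carry the factor [sin 0]. *)
Lemma fat_set_sin a : \int[mu]_(x in S) sin (a * x) = 0.
Proof.
have l (x y : R) : `|sin (a * x) - sin (a * y)| <= `|a| * `|x - y|.
  rewrite -normrM mulrBr -[leRHS]mul1r.
  exact: (lipschitz_of_derive (@is_derive_sin R) (@cos_max R)).
have h (c x : R) : sin (a * (c - x)) + sin (a * (c + x)) =
    2 * cos (a * x) * sin (a * c).
  by rewrite mulrBr mulrDr sinB sinD; ring.
have := fat_set_integral l h; rewrite mulr0 sin0.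
under eq_cvg do rewrite !mulr0.
move=> cI; rewrite -(cvg_lim (@Rhausdorff R) cI).
by apply: cvg_lim => //; exact: cvg_cst.
Qed.

(** The midpoint sums of the cosine are the partial products times [2 ^+ n * L n]. This factor tends
    to [gamma], which is nonzero, so dividing by it yields the convergence of the product as
    well. *)
Lemma fat_set_cos a :
  \prod_(1 <= j < n.+1) cos (a * fatx gamma j) @[n --> \oo] -->
  (\int[mu]_(x in S) cos (a * x)) / gamma.
Proof.
have l (x y : R) : `|cos (a * x) - cos (a * y)| <= `|a| * `|x - y|.
  rewrite -normrM mulrBr -[leRHS]mul1r.
  apply: (lipschitz_of_derive (@is_derive_cos R)) => z.
  by rewrite normrN; exact: sin_max.
have h (c x : R) : cos (a * (c - x)) + cos (a * (c + x)) =
    2 * cos (a * x) * cos (a * c).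
  by rewrite mulrBr mulrDr cosB cosD; ring.
have := fat_set_integral l h; rewrite mulr0 cos0.
have /andP[g0 _] := gamma01.
have cV : (2 ^+ n * L n)^-1 @[n --> \oo] --> gamma^-1.
  by apply: cvgV; [exact: lt0r_neq0|exact: expr2_fatL_cvg].
move=> cI; rewrite (_ : (fun n => _) = fun n =>
    2 ^+ n * L n * (\prod_(1 <= j < n.+1) cos (a * fatx gamma j) * 1) *
    (2 ^+ n * L n)^-1); first exact: cvgM.
apply/funext => n; rewrite mulr1 [X in X / _]mulrC mulfK//.
by rewrite mulf_neq0 ?expf_neq0// lt0r_neq0// fatL_gt0.
Qed.

(* The circle cut open at 0, which lies outside fat_set, instead of at 1/2:
   unlike fat_set, this set meets every fibre of proj at most once. *)
Definition recut_fat_set : set R :=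
  [set x | 0 <= x /\ S x] `|` [set x | x <= 1 /\ S (x - 1)].

Lemma recut_fat_set_itv x : recut_fat_set x -> 0 < x < 1.
Proof.
have neq0 y : S y -> y != 0.
  by move=> Sy; apply/eqP => y0; apply: fat_setN0; rewrite -y0.
move=> [[x0 Sx]|[x1 Sx]]; have := neq0 _ Sx; have := fat_set_itv Sx.
  by move=> xI xn0; rewrite lt_neqAle eq_sym xn0 x0/=; lra.
by move=> xI xn0; rewrite [x < 1]lt_neqAle -subr_eq0 xn0 x1/= andbT; lra.
Qed.

Lemma recut_fat_set_compact : compact recut_fat_set.
Proof.
have sub : recut_fat_set `<=` `[0, 1]%classic.
  by move=> x /recut_fat_set_itv; rewrite /= in_itv/=; lra.
apply: (subclosed_compact _ _ sub); last exact: segment_compact.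
apply: closedU; apply: closedI.
- exact: closed_ge.
- exact: fat_set_closed.
- exact: closed_le.
- apply: closed_comp => [x _|]; last exact: fat_set_closed.
  by apply: cvgB; [exact: cvg_id|exact: cvg_cst].
Qed.

Lemma recut_fat_set_perfect (x e : R) : recut_fat_set x -> 0 < e ->
  exists y, [/\ recut_fat_set y, y != x & `|x - y| < e].
Proof.
move=> Sx e0; have x01 := recut_fat_set_itv Sx.
(* Bounding the radius by the distances from [x] to 0 and 1 keeps the neighbour in the same half of
   the recut set. *)
have d0 : 0 < Num.min e (Num.min x (1 - x)) by rewrite !lt_min; lra.
case: Sx => -[_ /fat_set_perfect/(_ d0)[y [Sy yx]]];
  rewrite !lt_min => /and3P[xye]; rewrite !ltr_norml => h1 h2.
- by exists y; split=> //; left; split=> //; lra.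
- exists (y + 1); split.
  + by right; rewrite /= addrK; split=> //; lra.
  + by rewrite eq_sym -subr_eq eq_sym.
  + by rewrite (_ : x - (y + 1) = x - 1 - y)//; lra.
Qed.

(** A point [c] outside [S] has a ball outside [S], as [S] is closed; within that ball a further
    point [d + 1] is chosen with [d] outside [S], which avoids both halves. *)
Lemma recut_fat_set_meager x y : x < y ->
  exists2 c, x < c < y & ~ recut_fat_set c.
Proof.
move=> xy; have [c /andP[xc cy] nSc] := fat_set_meager xy.
have cS := fat_set_closed.
have /nbhs_ballP[e /= e0 ce] : nbhs c (~` S).
  by apply: open_nbhs_nbhs; split => //; exact: closed_openC.
have cy' : c - 1 < Num.min y (c + e) - 1 by rewrite ltrD2r lt_min cy ltrDl.
have [d /andP[cd dy] nSd] := fat_set_meager cy'.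
have [dy1 dy2] : d + 1 < y /\ d + 1 < c + e.
  by move: dy; rewrite ltrBrDr lt_min => /andP[].
exists (d + 1); first by lra.
move=> [[_]|[_]]; last by rewrite addrK.
by apply: ce; rewrite /ball/= ltr_norml; lra.
Qed.

(** * The fat Cantor set in the circle: topology, measure and Fourier transform *)

Local Notation B := (ternary_fat_cantor gamma).

Lemma proj_recut_fat_set : @proj R @` recut_fat_set = B.
Proof.
have projS (s t : R) : s - t = 1 -> proj s = proj t.
  by move=> st; apply/proj_eq; rewrite st rpred1.
apply/seteqP; split => _ [x Sx <-].
  case: Sx => -[_ Sx]; [by exists x|exists (x - 1) => //].
  by apply/esym/projS; rewrite opprB addrCA subrr addr0.
have [x0|/ltW x0] := leP 0 x; first by exists x => //; left.
exists (x + 1); first by right; rewrite /= addrK; split=> //; lra.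
by apply: projS; rewrite addrAC subrr add0r.
Qed.

(** The recut set lies in []0, 1[], so an integer difference of two of its points is 0. *)
Lemma proj_recut_fat_set_inj : {in recut_fat_set &, injective (@proj R)}.
Proof.
move=> x y; rewrite !inE => /recut_fat_set_itv x01 /recut_fat_set_itv y01.
move=> /proj_eq/intrP[n xyn].
have n1 : n%:~R < 1%:~R :> R by rewrite -xyn; lra.
have n2 : (- 1)%:~R < n%:~R :> R by rewrite -xyn mulrNz; lra.
move: n1 n2; rewrite !ltr_int => n1 n2; have n0 : n = 0 by lia.
by apply/eqP; rewrite -subr_eq0 xyn n0.
Qed.

Lemma recut_fat_set_homeomorphic :
  homeomorphic (set_type recut_fat_set) (set_type B).
Proof.
have BP (x : set_type recut_fat_set) : proj (set_val x) \in B.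
  rewrite inE -proj_recut_fat_set; exists (set_val x) => //.
  exact: (set_mem (valP x)).
pose f (x : set_type recut_fat_set) : set_type B :=
  exist (fun z => z \in B) _ (BP x).
apply: (@compact_bijective_homeomorphic _ _ f).
- exact/compact_set_type/recut_fat_set_compact.
- exact/hausdorff_set_type/circle_hausdorff.
- apply: continuous_set_val => x.
  exact: (@continuous_comp _ _ _ set_val (@proj R) x (@set_val_continuous _ _ x)
    (@proj_continuous R _)).
- rewrite -setTT_bijective; split=> //.
  + move=> x y _ _ /(congr1 set_val)/= xy; apply: val_inj.
    by apply: proj_recut_fat_set_inj => //; exact: valP.
  + move=> [y yB] _; have : (@proj R @` recut_fat_set) y.
      by rewrite proj_recut_fat_set; exact: set_mem yB.
    move=> [x Sx xy].
    exists (exist (fun z => z \in recut_fat_set) x (mem_set Sx)) => //.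
    exact: val_inj.
Qed.

Lemma ternary_fat_cantor_closed : closed B.
Proof.
apply: compact_closed; first exact: circle_hausdorff.
apply: continuous_compact; last exact: fat_set_compact.
exact/continuous_subspaceT/proj_continuous.
Qed.

Lemma ternary_fat_cantor_measurable : measurable B.
Proof.
rewrite -[X in measurable X]setCK; apply: measurableC.
apply: sub_sigma_algebra; exact/closed_openC/ternary_fat_cantor_closed.
Qed.

Lemma preimage_ternary_fat_cantor :
  @proj R @^-1` B `&` fundamental_domain = S `\ 2^-1.
Proof.
have [S1 S2] := fat_set_endpoints.
apply/seteqP; split => x [].
  move=> [s Ss /esym/proj_eq/intrP[n xs]].
  rewrite /fundamental_domain/= in_itv/= => xI.
  have sI := fat_set_itv Ss.
  have n1 : n%:~R < 1%:~R :> R by rewrite -xs; lra.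
  have n2 : (- 2)%:~R < n%:~R :> R by rewrite -xs mulrNz; lra.
  move: n1 n2; rewrite !ltr_int => n1 n2.
  split; last by move=> /= x2; lra.
  (* The value -1 occurs only for [s = 1/2] and [x = -1/2], the glued endpoints, and -1/2 also
     belongs to [S]. *)
  have [n0|n0] : n = 0 \/ n = -1 by lia.
    by move: xs; rewrite n0 => /eqP; rewrite subr_eq0 => /eqP ->.
  have -> : x = - 2^-1 by move: xs; rewrite n0 mulrNz; lra.
  exact: S1.
move=> Sx /= /eqP x2; split; first by exists x.
rewrite /fundamental_domain/= in_itv/= lt_neqAle x2/=.
by have := fat_set_itv Sx; lra.
Qed.

Lemma Rintegral_ternary_fat_cantor (h : circle R -> R) :
  measurable_fun setT h -> (forall x, `|h x| <= 1) ->
  \int[@haar R]_(x in B) h x = \int[mu]_(x in S) h (proj x).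
Proof.
move=> mh h1; rewrite Rintegral_haar//; last first.
  exact: ternary_fat_cantor_measurable.
rewrite preimage_ternary_fat_cantor /Rintegral; congr fine.
(* Removing the single point 1/2 leaves the Lebesgue integral unchanged. *)
apply: (@integral_setD1 _ (fun x => (h (proj x))%:E)).
  apply: measurableD => //.
  by apply: closed_measurable; exact: fat_set_closed.
apply: measurable_funTS; apply/measurable_EFinP.
by apply: measurableT_comp => //; exact: measurable_proj.
Qed.

Lemma haar_ternary_fat_cantor : haar B = gamma%:E.
Proof.
have : \int[@haar R]_(x in B) 1 = gamma.
  rewrite (@Rintegral_ternary_fat_cantor (cst 1)).
  - exact: fat_set_volume.
  - exact: measurable_cst.
  - by move=> x; rewrite normr1.
rewrite Rintegral_cst; last exact: ternary_fat_cantor_measurable.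
rewrite mul1r => hB; rewrite -[LHS]fineK ?hB//.
by apply: fin_num_measure; exact: ternary_fat_cantor_measurable.
Qed.

Lemma ternary_fat_cantor_is_fat_cantor : is_fat_cantor B.
Proof.
have /andP[g0 g1] := gamma01.
split; first exact: ternary_fat_cantor_measurable.
  by rewrite haar_ternary_fat_cantor lte_fin.
(* The chain leads from [B] to the recut set, then to the Cantor space, then to the ternary set. *)
apply: (homeomorphic_trans (homeomorphic_sym recut_fat_set_homeomorphic)).
apply: (homeomorphic_trans (homeomorphic_sym _)).
  apply: homeomorphic_cantor_space.
  - exact: recut_fat_set_compact.
  - exact: recut_fat_set_perfect.
  - exact: recut_fat_set_meager.
  - exists 2^-1; left; split; first by rewrite invr_ge0.
    by have [] := fat_set_endpoints.
apply: (@middle_cantor_homeomorphic _ _ _ (fun j => 3 ^- j)).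
- by rewrite expr0 invr1 subr0.
- by move=> j; rewrite exprSr invfM; lra.
- by move=> j; rewrite invr_gt0 exprn_gt0.
- by move=> j; rewrite invr_gt0 exprn_gt0.
Qed.

Lemma fourier_ternary_fat_cantor (k : int) :
  fourier (chi B) k = (\int[mu]_(x in S) cos (2 * pi * k%:~R * x))%:C.
Proof.
(* Here [c] is the lift of [e] to the line, and its continuity descends to the quotient; this
   handles the real and imaginary parts alike. *)
have Bint (c : R -> R) (e : circle R -> R) (h : circle R -> R) :
    (forall t, e (proj t) = c t) -> continuous c -> (forall t, `|c t| <= 1) ->
    (forall x, h x = \1_B x * e x) ->
    \int[@haar R]_x h x = \int[mu]_(x in S) c x.
  move=> ec cc c1 he.
  transitivity (\int[@haar R]_(x in B) e x).
    rewrite [RHS]Rintegral_mkcond; apply: eq_Rintegral => x _.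
    by rewrite he /patch indicE; case: ifP; rewrite ?mul1r ?mul0r.
  rewrite Rintegral_ternary_fat_cantor.
  - by apply: eq_Rintegral => x _.
  - apply: continuous_circle_measurable; apply/quotient_continuous.
    by rewrite (_ : _ \o _ = c)//; apply/funext => t; rewrite -ec.
  - by move=> x; have [t <-] := proj_surj x; rewrite ec.
have ca (a : R) : continuous (fun t : R => a * t).
  by move=> t; apply: cvgM; [exact: cvg_cst|exact: cvg_id].
rewrite /fourier /cintegral.
rewrite (Bint (fun t => cos (2 * pi * k%:~R * t))
  (fun x => complex.Re (echar (- k) x))); first last.
- by move=> x; rewrite /chi; case: (echar _ _) => u v /=; rewrite mul0r subr0.
- by move=> t; exact: cos_max.
- by move=> t; apply: continuous_comp; [exact: ca|exact: continuous_cos].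
- by move=> t; rewrite echarE/= mulrNz mulrN mulNr cosN.
(* The minus sign of the character stays inside the coefficient, so that [fat_set_sin] applies
   directly. *)
rewrite (Bint (fun t => sin (- (2 * pi * k%:~R) * t))
  (fun x => complex.Im (echar (- k) x))); first last.
- by move=> x; rewrite /chi; case: (echar _ _) => u v /=; rewrite mul0r addr0.
- by move=> t; exact: sin_max.
- by move=> t; apply: continuous_comp; [exact: ca|exact: continuous_sin].
- by move=> t; rewrite echarE/= mulrNz mulrN.
by rewrite fat_set_sin.
Qed.

End fat_set.

Theorem mainTheorem1 (R : realType) (gamma : R) :
  0 < gamma < 1 ->
  let B := ternary_fat_cantor gamma in
  [/\ is_fat_cantor B,
      haar B = gamma%:E &
      forall k : int,
        let P := fun n : nat =>
          \prod_(1 <= j < n.+1) cos (2 * pi * fatx gamma j * k%:~R) in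
        cvgn P /\ fourier (chi B) k = (fine (haar B) * limn P)%:C].
Proof.
move=> gamma01 B; split.
- exact: ternary_fat_cantor_is_fat_cantor.
- exact: haar_ternary_fat_cantor.
move=> k P.
have g0 : gamma != 0 by have /andP[g0 _] := gamma01; rewrite gt_eqF.
have PE : P = fun n =>
    \prod_(1 <= j < n.+1) cos (2 * pi * k%:~R * fatx gamma j).
  by apply/funext => n; apply: eq_bigr => j _; rewrite mulrAC.
have Pcvg := @fat_set_cos _ _ gamma01 (2 * pi * k%:~R); rewrite -PE in Pcvg.
split; first by apply/cvg_ex; eexists; exact: Pcvg.
rewrite (fourier_ternary_fat_cantor gamma01) (haar_ternary_fat_cantor gamma01).
(* The limit is the cosine integral divided by [gamma], and the factor [haar B] cancels this
   denominator. *)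
rewrite (cvg_lim _ Pcvg)//.
by congr (_%:C); rewrite [RHS]mulrC divfK.
Qed.
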